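(* Assume $b=d$. Let $(\zeta^N,\mathbf v^N)$, $\mathbf v^N=(v_1^N,v_2^N)$, be the solution, with values in $S_N\times S_N\times S_N$, of the Fourier–Galerkin semidiscrete problem $$(\zeta^N_t,\varphi)+r_1(\nabla\cdot\mathbf v^N,\varphi)+\lambda(\nabla\cdot(\zeta^N\mathbf v^N),\varphi)+a(\Delta\nabla\cdot\mathbf v^N,\varphi)-b(\Delta\zeta^N_t,\varphi)=0,\quad \varphi\in S_N,$$ $$\langle\mathbf v^N_t,\chi\rangle+r_2\langle\nabla\zeta^N,\chi\rangle+\tfrac{\lambda}{2}\langle\nabla|\mathbf v^N|^2,\chi\rangle+c'\langle\Delta\nabla\zeta^N,\chi\rangle-d\langle\Delta\mathbf v^N_t,\chi\rangle=0,\quad \chi\in S_N\times S_N,$$ $$\zeta^N(0)=P_N\zeta_0,\qquad \mathbf v^N(0)=P_N\mathbf v_0 .$$ Then, while this solution exists, $$\frac{d}{dt}H(\zeta^N,\mathbf v^N)=0,$$ where $$H(\zeta,\mathbf v)=\int_\Omega\left(-c'|\nabla\zeta|^2-a|\nabla\mathbf v|^2+(r_1+\lambda\zeta)|\mathbf v|^2+r_2\zeta^2\right)d\mathbf x .$$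
   Context: $\Omega=(0,1)^2$ and all functions are $1$-periodic in each spatial variable; the initial data $\zeta_0$ and $\mathbf v_0=(v_1^0,v_2^0)$ are real-valued. For an integer $N\ge1$, $S_N=\mathrm{span}\{e^{2\pi i(k_xx+k_yy)}: k_x,k_y\in\mathbb Z,\ -N\le k_x,k_y\le N\}$, and $P_N$ is the $L^2(\Omega)$-orthogonal projection onto $S_N$, applied componentwise to vectors. $(\cdot,\cdot)$ is the $L^2(\Omega)$ inner product and $\langle\cdot,\cdot\rangle$ the $L^2$ inner product of vector-valued functions. $|\mathbf v|^2=v_1^2+v_2^2$ and $|\nabla\mathbf v|^2=|\nabla v_1|^2+|\nabla v_2|^2$. Here $a,b,c,d$ are real constants with $b,d\ge0$, and, for parameters $0\le\gamma<1$ and $\delta>0$, $$\lambda=\frac{\delta^2-\gamma}{(\delta+\gamma)^2},\quad r_1=\frac{1}{\gamma+\delta},\quad r_2=1-\gamma,\quad c'=(1-\gamma)c.$$ *)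

(* Defs.v *)
From HB Require Import structures.
From mathcomp Require Import all_boot all_order all_algebra.
From mathcomp Require Import complex.
From mathcomp Require Import all_classical all_reals all_analysis.

Set Implicit Arguments.
Unset Strict Implicit.
Unset Printing Implicit Defensive.

Import Order.TTheory GRing.Theory Num.Theory.
Import numFieldNormedType.Exports.

Local Open Scope classical_set_scope.
Local Open Scope ring_scope.
Local Open Scope complex_scope.

Section Fields.
Context {R : realType}.

Definition scalar_field := (R * R)%type -> R[i].
Definition vector_field := (scalar_field * scalar_field)%type.

Implicit Types (f g : scalar_field) (v w : vector_field) (p : (R * R)%type).

Definition toC (f : (R * R)%type -> R) : scalar_field := fun p => (f p)%:C.

Definition mu2 := (@lebesgue_measure R \x @lebesgue_measure R)%E.

Definition Omega : set (R * R) := `]0, 1[%classic `*` `]0, 1[%classic.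

Definition cintegral f : R[i] :=
  (\int[mu2]_(p in Omega) complex.Re (f p)) +i* (\int[mu2]_(p in Omega) complex.Im (f p)).

Definition inner f g : R[i] := cintegral (fun p => f p * (g p)^*).

Definition vinner v w : R[i] := inner v.1 w.1 + inner v.2 w.2.

Definition periodic2 (f : (R * R)%type -> R) : Prop :=
  forall x y, f (x + 1, y) = f (x, y) /\ f (x, y + 1) = f (x, y).

Definition L2 (f : (R * R)%type -> R) : Prop :=
  measurable_fun Omega f /\
  mu2.-integrable Omega (fun p => ((f p) ^+ 2)%:E).

Definition fourier (kx ky : int) : scalar_field := fun p =>
  let theta := 2 * pi * (kx%:~R * p.1 + ky%:~R * p.2) in
  cos theta +i* sin theta.

(* The index i < 2N+1 stands for the frequency i - N. *)
Definition SN (N : nat) : set scalar_field :=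
  [set f | exists A : 'M[R[i]]_((2 * N).+1), forall p,
    f p = \sum_i \sum_j A i j * fourier (i%:Z - N%:Z) (j%:Z - N%:Z) p].

(* g = P_N f, the L^2(Omega)-orthogonal projection of f onto S_N. *)
Definition is_PN (N : nat) (f g : scalar_field) : Prop :=
  SN N g /\ forall phi, SN N phi -> inner (fun p => f p - g p) phi = 0.

Definition partial (e : (R * R)%type) f : scalar_field := fun p =>
  ('D_e (fun q => complex.Re (f q)) p) +i* ('D_e (fun q => complex.Im (f q)) p).

Definition dx f := partial (1, 0) f.
Definition dy f := partial (0, 1) f.

Definition grad f : vector_field := (dx f, dy f).
Definition div v : scalar_field := fun p => dx v.1 p + dy v.2 p.
Definition lap f : scalar_field := fun p => dx (dx f) p + dy (dy f) p.
Definition vlap v : vector_field := (lap v.1, lap v.2).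
Definition fscale f v : vector_field :=
  (fun p => f p * v.1 p, fun p => f p * v.2 p).

(* |v|^2 = v_1^2 + v_2^2, literally: squares, not squared moduli, of the
   components.  The two agree on real-valued fields; the nonlinearity of the
   system and the energy both use this one. *)
Definition sqn v : scalar_field := fun p => v.1 p ^+ 2 + v.2 p ^+ 2.

(* Derivative at t of a function of time known on J only; it is one-sided at an
   endpoint of J that belongs to J. *)
Definition has_derive_within (J : set R) (h : R -> R) (t l : R) : Prop :=
  (fun s => (h s - h t) / (s - t)) @ within J (dnbhs t) --> l.

Definition has_cderive_within (J : set R) (h : R -> R[i]) (t : R) (l : R[i]) :
    Prop :=
  has_derive_within J (fun s => complex.Re (h s)) t (complex.Re l) /\
  has_derive_within J (fun s => complex.Im (h s)) t (complex.Im l).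

Definition has_dt (J : set R) (u : R -> scalar_field) (t : R)
    (ut : scalar_field) : Prop :=
  forall p, has_cderive_within J (fun s => u s p) t (ut p).

Definition lambda (gamma delta : R) : R :=
  (delta ^+ 2 - gamma) / (delta + gamma) ^+ 2.
Definition r1 (gamma delta : R) : R := (gamma + delta)^-1.
Definition r2 (gamma : R) : R := 1 - gamma.
Definition c' (gamma c : R) : R := (1 - gamma) * c.

Definition mass_eq (a b gamma delta : R) (zeta zetat : scalar_field)
    (v : vector_field) (phi : scalar_field) : Prop :=
  inner zetat phi
  + (r1 gamma delta)%:C * inner (div v) phi
  + (lambda gamma delta)%:C * inner (div (fscale zeta v)) phi
  + a%:C * inner (lap (div v)) phi
  - b%:C * inner (lap zetat) phi = 0.

Definition momentum_eq (c d gamma delta : R) (zeta : scalar_field)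
    (v vt chi : vector_field) : Prop :=
  vinner vt chi
  + (r2 gamma)%:C * vinner (grad zeta) chi
  + (lambda gamma delta / 2)%:C * vinner (grad (sqn v)) chi
  + (c' gamma c)%:C * vinner (vlap (grad zeta)) chi
  - d%:C * vinner (vlap vt) chi = 0.

Record galerkin_solution (N : nat) (a b c d gamma delta : R)
    (zeta0 v10 v20 : (R * R)%type -> R) (J : set R)
    (zeta : R -> scalar_field) (v : R -> vector_field) : Prop := GalerkinSolution {
  gs_interval : is_interval J ;
  gs_zero : J 0 ;
  gs_SN : forall t, J t -> [/\ SN N (zeta t), SN N (v t).1 & SN N (v t).2] ;
  gs_eqs : forall t, J t ->
    exists (zetat : scalar_field) (vt : vector_field),
      [/\ has_dt J zeta t zetat,
          has_dt J (fun s => (v s).1) t vt.1,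
          has_dt J (fun s => (v s).2) t vt.2,
          forall phi, SN N phi ->
            mass_eq a b gamma delta (zeta t) zetat (v t) phi &
          forall chi, SN N chi.1 -> SN N chi.2 ->
            momentum_eq c d gamma delta (zeta t) (v t) vt chi] ;
  gs_init : [/\ is_PN N (toC zeta0) (zeta 0),
                is_PN N (toC v10) (v 0).1 &
                is_PN N (toC v20) (v 0).2]
}.

Definition energy (a c gamma delta : R) (zeta : scalar_field) (v : vector_field) : R[i] :=
  cintegral (fun p =>
    - (c' gamma c)%:C * sqn (grad zeta) p
    - a%:C * (sqn (grad v.1) p + sqn (grad v.2) p)
    + ((r1 gamma delta)%:C + (lambda gamma delta)%:C * zeta p) * sqn v p
    + (r2 gamma)%:C * zeta p ^+ 2).

End Fields.

Arguments scalar_field : clear implicits.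
Arguments vector_field : clear implicits.

(* Main.v *)
Require Import Defs.
From mathcomp Require Import all_boot all_order all_algebra.
From mathcomp Require Import complex.
From mathcomp Require Import all_classical all_reals all_analysis.
From mathcomp Require Import measurable_realfun.
From mathcomp Require Import ring lra zify.

(* The identity is complex-bilinear: write <f, g> for the integral of f g, without
   conjugation; since S_N is stable under conjugation, the Galerkin equations may
   be tested in this pairing.  Let F0 and G0 be half the variational derivatives of H in
   zeta and v, and F, G their projections on S_N.  Then H' / 2 is
   <F, zeta_t> + <G, v_t>.  As b = d, both equations carry the same operator
   A = 1 - b lap, which is invertible on S_N and commutes with derivatives.
   Testing them with psi = A^-1 F and Psi = A^-1 G gives
     <F, zeta_t> = <psi, A zeta_t> = <G0, grad psi> = <Psi, grad F>,
     <G, v_t> = <Psi, A v_t> = <F0, div Psi> = - <Psi, grad F>.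
   To differentiate under the integral, the Fourier coefficients of the solution
   are recovered from its values on a finite grid by the discrete Fourier
   transform, so pointwise differentiability in time passes to them.  If t is
   isolated in J every limit holds, and the claim is trivial. *)

Local Open Scope ring_scope.

Set Implicit Arguments.
Unset Strict Implicit.
Unset Printing Implicit Defensive.

Import Order.TTheory GRing.Theory Num.Theory.
Import numFieldNormedType.Exports.

(** * Trigonometric polynomials *)

Section TrigonometricPolynomials.
Context {R : realType}.
Implicit Types (f g : scalar_field R) (p e : (R * R)%type) (k l : int).

Definition phase k l p : R := 2 * pi * (k%:~R * p.1 + l%:~R * p.2).

Lemma fourierM k l k' l' p :
  fourier k l p * fourier k' l' p = fourier (k + k') (l + l') p.
Proof.
rewrite /fourier /=.
have -> : 2 * pi * ((k + k')%:~R * p.1 + (l + l')%:~R * p.2) =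
  phase k l p + phase k' l' p :> R by rewrite /phase !intrD; ring.
rewrite cosD sinD /phase; apply/eqP; rewrite eq_complex /= eqxx /=.
by apply/eqP; ring.
Qed.

Lemma fourier0 p : fourier 0 0 p = 1 :> R[i].
Proof. by rewrite /fourier !mul0r addr0 mulr0 cos0 sin0. Qed.

Lemma conj_fourier k l p : (fourier k l p)^* = fourier (- k) (- l) p :> R[i].
Proof.
rewrite /fourier.
have -> : 2 * pi * ((- k)%:~R * p.1 + (- l)%:~R * p.2) = - phase k l p :> R.
  by rewrite /phase !intrN; ring.
by rewrite cosN sinN.
Qed.

(** Generation by modes and sums makes every linear property a two-case induction. The predicate [P]
    on frequencies lets one type serve for all trigonometric polynomials and for [S_N]. *)
Inductive trig (P : int -> int -> Prop) : scalar_field R -> Prop :=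
| trig_mono c k l : P k l -> trig P (fun p => c * fourier k l p)
| trig_add f g : trig P f -> trig P g -> trig P (fun p => f p + g p).

Definition anyfreq k l := True.
Definition lowfreq (N : nat) k l := (`|k| <= N%:Z) /\ (`|l| <= N%:Z).

Lemma trigW P f : trig P f -> trig anyfreq f.
Proof. by elim=> *; [apply: trig_mono | apply: trig_add]. Qed.

Lemma trig_scale P a f : trig P f -> trig P (fun p => a * f p).
Proof.
elim=> [c k l Pkl|f1 g1 _ IHf _ IHg].
  rewrite (_ : (fun _ => _) = fun p => (a * c) * fourier k l p) ?[LHS]/=; last first.
    by apply/funext => p; rewrite mulrA.
  exact: trig_mono.
rewrite (_ : (fun _ => _) = fun p => a * f1 p + a * g1 p); first exact: trig_add.
by apply/funext => p; rewrite mulrDr.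
Qed.

Lemma trig_opp P f : trig P f -> trig P (fun p => - f p).
Proof.
move=> /(trig_scale (-1)); congr trig.
by apply/funext => p; rewrite mulN1r.
Qed.

Lemma trig_sub P f g : trig P f -> trig P g -> trig P (fun p => f p - g p).
Proof. by move=> Pf /trig_opp; apply: trig_add. Qed.

(** The zero function is a hypothesis because of the empty sum: for an empty [P] nothing satisfies
    [trig P]. *)
Lemma trig_sum P (I : finType) (F : I -> scalar_field R) :
  trig P (fun=> 0) -> (forall i, trig P (F i)) -> trig P (fun p => \sum_i F i p).
Proof.
move=> P0 PF; elim: index_enum => [|i s IH].
  by move: P0; congr trig; apply/funext => p; rewrite big_nil.
move: (trig_add (PF i) IH); congr trig.
by apply/funext => p; rewrite big_cons.
Qed.

Lemma trig_cst a : trig anyfreq (fun=> a).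
Proof.
have : trig anyfreq (fun p => a * fourier 0 0 p) by exact: trig_mono.
by congr trig; apply/funext => p; rewrite fourier0 mulr1.
Qed.

Lemma trig_mul f g :
  trig anyfreq f -> trig anyfreq g -> trig anyfreq (fun p => f p * g p).
Proof.
elim=> [c k l _|f1 f2 _ IH1 _ IH2] Pg; last first.
  move: (trig_add (IH1 Pg) (IH2 Pg)); congr trig.
  by apply/funext => p; rewrite mulrDl.
elim: Pg => [c' k' l' _|g1 g2 _ IH1 _ IH2].
  have : trig anyfreq (fun p => (c * c') * fourier (k + k') (l + l') p).
    exact: trig_mono.
  congr trig; apply/funext => p; rewrite -fourierM; ring.
move: (trig_add IH1 IH2); congr trig.
by apply/funext => p; rewrite mulrDr.
Qed.

Lemma trig_conj N f : trig (lowfreq N) f -> trig (lowfreq N) (fun p => (f p)^*).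
Proof.
elim=> [c k l [Pk Pl]|f1 f2 _ IH1 _ IH2]; last first.
  move: (trig_add IH1 IH2); congr trig.
  by apply/funext => p; rewrite rmorphD.
have : trig (lowfreq N) (fun p => c^* * fourier (- k) (- l) p).
  by apply: trig_mono; split; rewrite normrN.
by congr trig; apply/funext => p; rewrite rmorphM -conj_fourier.
Qed.

(** * Directional derivatives as Fourier multipliers *)

(** The phase is linear in the point, so its slope in the direction [e] is its value at [e]; the
    derivative along [e] thus multiplies the mode by [i] times [phase k l e]. *)
Definition deriv_symbol e k l : R[i] := Complex 0 (phase k l e).

(** Along the line through [p] in the direction [e] the phase is affine, so the one-variable chain
    rule applies. *)
Lemma is_derive_phase (G : R -> R) k l p e dG :
  is_derive (phase k l p) 1 G dG ->
  is_derive p e (fun q => G (phase k l q)) (phase k l e * dG).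
Proof.
move=> HG.
pose phi (h : R) := G (h * phase k l e + phase k l p).
have Hphi : is_derive (0 : R) 1 phi (phase k l e * dG).
  have Hlin : is_derive (0 : R) 1 (fun h : R => h * phase k l e + phase k l p)
    (phase k l e).
    have : is_derive (0 : R) 1 ((phase k l e \*: (id : R -> R)) + cst (phase k l p))
       (phase k l e *: 1 + 0) by apply: is_deriveD.
    rewrite [phase k l e *: 1]mulr1 addr0; congr is_derive.
    by apply/funext => h; rewrite /= mulrC.
  rewrite mulrC; apply: (@is_derive1_comp _ G) => //.
  by rewrite mul0r add0r.
have E : (fun h : R => h^-1 *: (G (phase k l (h *: e + p)) - G (phase k l p))) =
         (fun h : R => h^-1 *: (phi (h *: 1 + 0) - phi 0)).
  apply/funext => h; rewrite /phi mul0r add0r addr0; congr (_ *: (G _ - _)).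
  by rewrite /phase /= -![_ *: _]/(_ * _); ring.
case: Hphi => d1 d2; split.
  by rewrite /derivable /= E.
by rewrite /derive /= E.
Qed.

(* Locked: comparing two distinct directional derivatives by unfolding is
   prohibitively slow. *)
Definition pd : (R * R)%type -> scalar_field R -> scalar_field R := locked partial.

Lemma partial_pd : partial = pd.
Proof. by rewrite /pd -lock. Qed.

(** The operator ['D_e] is total and has a value even where no derivative exists; this predicate
    carries existence along with the value, as the sum rule requires. *)
Definition is_partial e f p (d : R[i]) :=
  is_derive p e (fun q => complex.Re (f q)) (complex.Re d) /\
  is_derive p e (fun q => complex.Im (f q)) (complex.Im d).

Lemma is_partialE e f p d : is_partial e f p d -> pd e f p = d.
Proof. by case=> d1 d2; rewrite -partial_pd /partial !derive_val; case: d {d1 d2}. Qed.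

Lemma is_partialD e f g p d1 d2 : is_partial e f p d1 -> is_partial e g p d2 ->
  is_partial e (fun q => f q + g q) p (d1 + d2).
Proof.
move=> [f1 f2] [g1 g2]; split; rewrite raddfD /=.
  rewrite (_ : (fun _ => _) = (fun q => complex.Re (f q)) + (fun q => complex.Re (g q))).
    exact: is_deriveD.
  by apply/funext => q; rewrite raddfD.
rewrite (_ : (fun _ => _) = (fun q => complex.Im (f q)) + (fun q => complex.Im (g q))).
  exact: is_deriveD.
by apply/funext => q; rewrite raddfD.
Qed.

Lemma is_partial_mono e c k l p :
  is_partial e (fun q => c * fourier k l q) p (deriv_symbol e k l * c * fourier k l p).
Proof.
have Hc := is_derive_phase e (is_derive_cos (phase k l p)).
have Hs := is_derive_phase e (is_derive_sin (phase k l p)).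
case: c => x y; split.
  rewrite (_ : (fun _ => _) = (x \*: (fun q => cos (phase k l q)))
     - (y \*: (fun q => sin (phase k l q)))) //.
  apply: is_derive_eq.
  rewrite /deriv_symbol /fourier -/(phase k l p) /= -![_ *: _]/(_ * _); ring.
rewrite (_ : (fun _ => _) = (x \*: (fun q => sin (phase k l q)))
   + (y \*: (fun q => cos (phase k l q)))) //.
apply: is_derive_eq.
rewrite /deriv_symbol /fourier -/(phase k l p) /= -![_ *: _]/(_ * _); ring.
Qed.

Lemma trig_is_partial e f p : trig anyfreq f -> is_partial e f p (pd e f p).
Proof.
elim=> [c k l _|f1 g1 _ IH1 _ IH2].
  have H := is_partial_mono e c k l p; by rewrite (is_partialE H).
have H := is_partialD IH1 IH2; by rewrite (is_partialE H).
Qed.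

Lemma pdD e f g : trig anyfreq f -> trig anyfreq g ->
  pd e (fun p => f p + g p) = fun p => pd e f p + pd e g p.
Proof.
move=> tf tg; apply/funext => p; apply: is_partialE.
by apply: is_partialD; apply: trig_is_partial.
Qed.

Lemma pd_mono e c k l :
  pd e (fun q => c * fourier k l q) =
  fun p => deriv_symbol e k l * c * fourier k l p.
Proof. by apply/funext => p; apply/is_partialE/is_partial_mono. Qed.

Lemma trig_pd P e f : trig P f -> trig P (pd e f).
Proof.
elim=> [c k l Pkl|f1 g1 t1 IH1 t2 IH2].
  by rewrite pd_mono; apply: trig_mono.
by rewrite pdD; [apply: trig_add|apply: trigW t1|apply: trigW t2].
Qed.

Lemma pdZ e a f : trig anyfreq f ->
  pd e (fun p => a * f p) = fun p => a * pd e f p.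
Proof.
elim=> [c k l _|f1 g1 t1 IH1 t2 IH2].
  rewrite (_ : (fun p => _) = fun p => (a * c) * fourier k l p); last first.
    by apply/funext => p; rewrite mulrA.
  by rewrite !pd_mono; apply/funext => p; ring.
rewrite (_ : (fun p => _) = fun p => a * f1 p + a * g1 p); last first.
  by apply/funext => p; rewrite mulrDr.
rewrite !pdD ?IH1 ?IH2//; try exact: trig_scale.
by apply/funext => p; rewrite mulrDr.
Qed.

(** Both sides are bilinear in [f] and [g], and on a pair of modes the rule is the additivity of
    [deriv_symbol] in the frequency. *)
Lemma pdM e f g : trig anyfreq f -> trig anyfreq g ->
  pd e (fun p => f p * g p) =
  fun p => pd e f p * g p + f p * pd e g p.
Proof.
move=> tf tg; elim: tf => [c k l _|f1 f2 t1 IH1 t2 IH2]; last first.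
  rewrite (_ : (fun p => _ * g p) = fun p => f1 p * g p + f2 p * g p); last first.
    by apply/funext => p; rewrite mulrDl.
  rewrite !pdD ?IH1 ?IH2//; try exact: trig_mul.
  by apply/funext => p; ring.
elim: tg => [c' k' l' _|g1 g2 t1 IH1 t2 IH2].
  rewrite (_ : (fun p => _ * _) =
     fun p => (c * c') * fourier (k + k') (l + l') p); last first.
    by apply/funext => p; rewrite -fourierM; ring.
  rewrite !pd_mono; apply/funext => p; rewrite -fourierM.
  have -> : deriv_symbol e (k + k') (l + l') = deriv_symbol e k l + deriv_symbol e k' l'.
    apply/eqP; rewrite eq_complex /= addr0 eqxx /=; apply/eqP.
    by rewrite /phase !intrD; ring.
  by ring.
have tm : trig anyfreq (fun p => c * fourier k l p) by exact: trig_mono.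
rewrite (_ : (fun p => _ * (_ + _)) =
  fun p => c * fourier k l p * g1 p + c * fourier k l p * g2 p); last first.
  by apply/funext => p; rewrite mulrDr.
rewrite [in LHS]pdD ?IH1 ?IH2//; try exact: trig_mul.
rewrite [pd e (fun p => g1 p + g2 p)]pdD//.
by apply/funext => p; ring.
Qed.

Lemma pdC e e' f : trig anyfreq f ->
  pd e (pd e' f) = pd e' (pd e f).
Proof.
elim=> [c k l _|f1 g1 t1 IH1 t2 IH2].
  by rewrite !pd_mono; apply/funext => p; ring.
rewrite (pdD e' t1 t2) (pdD e t1 t2).
have t e0 h := @trig_pd anyfreq e0 h.
rewrite (pdD e (t e' _ t1) (t e' _ t2)) (pdD e' (t e _ t1) (t e _ t2)).
by rewrite IH1 IH2.
Qed.

End TrigonometricPolynomials.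

(** * Integration over the unit square *)

Section Integrals.
Context {R : realType}.
Implicit Types (f g : scalar_field R) (p e : (R * R)%type) (k l : int).

Let leb := @lebesgue_measure R.

Lemma measurable_Omega :
  @measurable _ (measurableTypeR R * measurableTypeR R)%type (@Omega R).
Proof. by apply: measurableX. Qed.

Lemma mu2_Omega_lty : (@mu2 R (@Omega R) < +oo)%E.
Proof.
rewrite /mu2 product_measure1E//=.
by rewrite !lebesgue_measure_itv /= lte_fin ltr01 -EFinB -EFinM ltry.
Qed.

Lemma measurable_phase k l : measurable_fun setT (@phase R k l).
Proof.
apply: measurable_funM => //; apply: measurable_funD; apply: measurable_funM => //.
Qed.

Lemma integrable_phase (G : R -> R) k l : continuous G ->
  (forall x, `|G x| <= 1) ->
  (@mu2 R).-integrable (@Omega R) (EFin \o (fun p => G (phase k l p))).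
Proof.
move=> cG bG; apply: measurable_bounded_integrable.
- exact: measurable_Omega.
- exact: mu2_Omega_lty.
- apply: (@measurable_funS _ _ _ _ setT) => //.
  apply: (@measurableT_comp _ _ _ _ _ _ G); last exact: measurable_phase.
  exact: continuous_measurable_fun.
- exists 1; split => // M M1 p _ /=.
  by rewrite (le_trans (bG _))// ltW.
Qed.

(** The antiderivative [w^-1 * H (w * x + a)] takes the same value at 0 and at 1. *)
Lemma integral01_phase (G H : R -> R) (a w : R) : w != 0 -> continuous G ->
  (forall x : R, is_derive x 1 H (G x)) -> H (w + a) = H a ->
  (\int[leb]_(x in `]0%R, 1%R[) (G (w * x + a))%:E = 0)%E.
Proof.
move=> w0 cG dH HE.
have cGa : continuous (fun x : R => G (w * x + a)).
  move=> x; apply: (@continuous_comp _ _ _ (fun x => w * x + a) G); last exact: cG.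
  by apply: cvgD; [apply: cvgMl_tmp; exact: cvg_id | exact: cvg_cst].
have dF (x : R) : is_derive x 1 (fun x : R => w^-1 * H (w * x + a)) (G (w * x + a)).
  have Hl : is_derive x 1 (fun x : R => w * x + a) w.
    have : is_derive x 1 ((w \*: (id : R -> R)) + cst a) (w *: 1 + 0).
      by apply: is_deriveD.
    by rewrite [w *: 1]mulr1 addr0; congr is_derive.
  have := is_deriveZ w^-1 (@is_derive1_comp _ H (fun x : R => w * x + a) x _ _ (dH _) Hl).
  by rewrite [_ *: (_ * _)]mulrCA mulVf// mulr1.
(* The fundamental theorem of calculus is applied on the closed interval, which has the same
   integral. *)
rewrite -(@integral_itv_bndoo _ 0 1 _ true false); last first.
  apply/measurable_EFinP; apply: measurable_funS (continuous_measurable_fun cGa) => //.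
have cF : continuous (fun x : R => w^-1 * H (w * x + a)).
  move=> x; apply: differentiable_continuous; apply/derivable1_diffP.
  exact: (@ex_derive _ _ _ _ _ _ _ (dF x)).
rewrite (@continuous_FTC2 _ _ (fun x : R => w^-1 * H (w * x + a)) 0 1 ltr01).
- by rewrite mulr1 mulr0 add0r HE subee.
- exact: continuous_subspaceT.
- split.
  + by move=> x _; exact: (@ex_derive _ _ _ _ _ _ _ (dF x)).
  + by apply: cvg_at_right_filter; exact: cF.
  + by apply: cvg_at_left_filter; exact: cF.
- by move=> x _; rewrite derive1E derive_val.
Qed.

(* Integrate first in a variable along which the phase is not constant. *)
Lemma Rintegral_phase (G H : R -> R) k l : (k != 0) || (l != 0) ->
  continuous G -> (forall x, `|G x| <= 1) ->
  (forall x : R, is_derive x 1 H (G x)) ->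
  (forall n (x : R), H (2 * pi * n%:~R + x) = H x) ->
  \int[@mu2 R]_(p in @Omega R) G (phase k l p) = 0.
Proof.
move=> kl cG bG dH HE.
have twopi : (2 * pi : R) != 0 by rewrite mulf_neq0// gt_eqF// pi_gt0.
rewrite /Rintegral integral_mkcond.
(* The integrand is extended by zero to the whole plane, where Fubini's theorem for the product
   measure applies. *)
have I : (@mu2 R).-integrable setT
   ((EFin \o (fun p => G (phase k l p))) \_ (@Omega R)).
  apply/integrable_restrict => //; first exact: measurable_Omega.
  rewrite setTI; exact: integrable_phase.
suff -> : (\int[@mu2 R]_p ((EFin \o (fun p => G (phase k l p))) \_ (@Omega R)) p = 0)%E
  by [].
case/orP: kl => n0.
- rewrite /mu2 -(integral21_prod_meas1 I); apply: integral0_eq => y _.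
  rewrite /fubini_G.
  have [yI|yI] := boolP (y \in `]0%R, 1%R[); last first.
    apply: integral0_eq => x _; rewrite patchE; case: ifPn => //.
    by rewrite inE => -[/= _]; rewrite (negPf yI).
  have := @integral01_phase G H (2 * pi * (l%:~R * y)) (2 * pi * k%:~R) _ cG dH.
  rewrite mulf_neq0 ?intr_eq0// => /(_ isT (HE _ _)) <-.
  rewrite [RHS]integral_mkcond; apply: eq_integral => x _.
  rewrite !patchE; congr (if _ then _ else _); last first.
    by rewrite /= /phase /=; congr ((G _)%:E); ring.
  by apply/idP/idP; rewrite !inE /Omega /= => // -[].
- rewrite /mu2 -(integral12_prod_meas1 I); apply: integral0_eq => x _.
  rewrite /fubini_F.
  have [xI|xI] := boolP (x \in `]0%R, 1%R[); last first.
    apply: integral0_eq => y _; rewrite patchE; case: ifPn => //.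
    by rewrite inE => -[/= ]; rewrite (negPf xI).
  have := @integral01_phase G H (2 * pi * (k%:~R * x)) (2 * pi * l%:~R) _ cG dH.
  rewrite mulf_neq0 ?intr_eq0// => /(_ isT (HE _ _)) <-.
  rewrite [RHS]integral_mkcond; apply: eq_integral => y _.
  rewrite !patchE; congr (if _ then _ else _); last first.
    by rewrite /= /phase /=; congr ((G _)%:E); ring.
  by apply/idP/idP; rewrite !inE /Omega /= => // -[].
Qed.

Lemma cos_2piZ n (x : R) : cos (2 * pi * n%:~R + x) = cos x.
Proof.
have H (m : nat) (y : R) : cos (2 * pi * m%:R + y) = cos y.
  elim: m => [|m IH]; first by rewrite mulr0 add0r.
  rewrite -IH -[in RHS]cosD2pi; congr cos.
  by rewrite -natr1 -mulr_natl; ring.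
case: n => m; first exact: H.
(* Here [n] is [-(m + 1)], and adding [m + 1] periods brings the argument back to [x]. *)
rewrite -(H m.+1); congr cos; rewrite NegzE intrN; ring.
Qed.

Lemma sin_2piZ n (x : R) : sin (2 * pi * n%:~R + x) = sin x.
Proof. by rewrite -!cosBpihalf -addrA cos_2piZ. Qed.

Lemma integrable_cos_phase k l :
  (@mu2 R).-integrable (@Omega R) (EFin \o (fun p => cos (phase k l p))).
Proof.
apply: (@integrable_phase cos); first exact: continuous_cos.
by move=> x; rewrite ler_norml cos_geN1 cos_le1.
Qed.

Lemma integrable_sin_phase k l :
  (@mu2 R).-integrable (@Omega R) (EFin \o (fun p => sin (phase k l p))).
Proof.
apply: (@integrable_phase sin); first exact: continuous_sin.
by move=> x; rewrite ler_norml sin_geN1 sin_le1.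
Qed.

(** * Integration of complex-valued functions *)

Definition cintegrable f :=
  (@mu2 R).-integrable (@Omega R) (EFin \o (fun p => complex.Re (f p))) /\
  (@mu2 R).-integrable (@Omega R) (EFin \o (fun p => complex.Im (f p))).

Lemma cintegrableD f g : cintegrable f -> cintegrable g ->
  cintegrable (fun p => f p + g p).
Proof.
move=> [f1 f2] [g1 g2]; have mO := measurable_Omega; split.
  under eq_fun do rewrite raddfD; exact: (integrableD mO f1 g1).
under eq_fun do rewrite raddfD; exact: (integrableD mO f2 g2).
Qed.

Lemma integrable_lin (u v : (R * R)%type -> R) (x y : R) :
  (@mu2 R).-integrable (@Omega R) (EFin \o u) ->
  (@mu2 R).-integrable (@Omega R) (EFin \o v) ->
  (@mu2 R).-integrable (@Omega R) (EFin \o (fun p => x * u p + y * v p)).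
Proof.
move=> iu iv; have mO := measurable_Omega.
exact: (integrableD mO (integrableZl mO x iu) (integrableZl mO y iv)).
Qed.

Lemma Rintegral_lin (u v : (R * R)%type -> R) (x y : R) :
  (@mu2 R).-integrable (@Omega R) (EFin \o u) ->
  (@mu2 R).-integrable (@Omega R) (EFin \o v) ->
  \int[@mu2 R]_(p in @Omega R) (x * u p + y * v p) =
  x * (\int[@mu2 R]_(p in @Omega R) u p) + y * (\int[@mu2 R]_(p in @Omega R) v p).
Proof.
move=> iu iv; have mO := measurable_Omega.
rewrite (RintegralD mO (integrableZl mO x iu) (integrableZl mO y iv)).
by rewrite !RintegralZl.
Qed.

(** The minus sign is attached to the coefficient so that the right-hand side has the shape of
    [integrable_lin] and [Rintegral_lin]. *)
Lemma Re_mulc (x y : R[i]) :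
  complex.Re (x * y) = complex.Re x * complex.Re y + (- complex.Im x) * complex.Im y.
Proof. by case: x y => [x1 x2] [y1 y2] /=; rewrite mulNr. Qed.

Lemma Im_mulc (x y : R[i]) :
  complex.Im (x * y) = complex.Re x * complex.Im y + complex.Im x * complex.Re y.
Proof. by case: x y => [x1 x2] [y1 y2] /=. Qed.

Lemma cintegrableZ a f : cintegrable f -> cintegrable (fun p => a * f p).
Proof.
move=> [f1 f2]; split.
  under eq_fun do rewrite Re_mulc; exact: integrable_lin.
under eq_fun do rewrite Im_mulc; exact: integrable_lin.
Qed.

Lemma cintegralD f g : cintegrable f -> cintegrable g ->
  cintegral (fun p => f p + g p) = cintegral f + cintegral g.
Proof.
move=> [f1 f2] [g1 g2]; apply/eqP; rewrite eq_complex /=.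
rewrite -!RintegralD//; try exact: measurable_Omega.
by apply/andP; split; apply/eqP; apply: eq_Rintegral => p _; rewrite raddfD.
Qed.

Lemma cintegralZ a f : cintegrable f ->
  cintegral (fun p => a * f p) = a * cintegral f.
Proof.
move=> [f1 f2]; apply/eqP; rewrite eq_complex Re_mulc Im_mulc /=.
rewrite -!Rintegral_lin//.
by apply/andP; split; apply/eqP; apply: eq_Rintegral => p _; rewrite ?Re_mulc ?Im_mulc.
Qed.

Lemma trig_cintegrable f : trig anyfreq f -> cintegrable f.
Proof.
elim=> [c k l _|f1 g1 _ IH1 _ IH2]; last exact: cintegrableD.
apply: cintegrableZ; split; first exact: integrable_cos_phase.
exact: integrable_sin_phase.
Qed.

Lemma cintegral_fourier k l : (k != 0) || (l != 0) ->
  cintegral (fourier k l) = 0 :> R[i].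
Proof.
move=> kl; rewrite /cintegral.
have cos_le x : `|cos x| <= 1 :> R by rewrite ler_norml cos_geN1 cos_le1.
have sin_le x : `|sin x| <= 1 :> R by rewrite ler_norml sin_geN1 sin_le1.
have dNcos (x : R) : is_derive x 1 (fun y => - cos y) (sin x).
  by have := is_deriveN (is_derive_cos x); rewrite opprK.
have Ncos_2piZ n (x : R) : - cos (2 * pi * n%:~R + x) = - cos x by rewrite cos_2piZ.
have /= := Rintegral_phase kl (@continuous_cos R) cos_le (@is_derive_sin R) sin_2piZ.
have /= := Rintegral_phase kl (@continuous_sin R) sin_le dNcos Ncos_2piZ.
by rewrite /phase => -> ->.
Qed.

Lemma cintegral_mono c k l : (k != 0) || (l != 0) ->
  cintegral (fun p => c * fourier k l p) = 0 :> R[i].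
Proof.
move=> kl; rewrite cintegralZ ?cintegral_fourier ?mulr0//.
split; [exact: integrable_cos_phase|exact: integrable_sin_phase].
Qed.

(** A nonconstant mode has integral zero, and the symbol of the constant mode vanishes. This is why
    integration by parts leaves no boundary term. *)
Lemma cintegral_pd e f : trig anyfreq f -> cintegral (pd e f) = 0.
Proof.
elim=> [c k l _|f1 g1 t1 IH1 t2 IH2]; last first.
  rewrite pdD// cintegralD ?IH1 ?IH2 ?addr0//.
    exact/trig_cintegrable/trig_pd.
  exact/trig_cintegrable/trig_pd.
rewrite pd_mono.
have [kl|] := boolP ((k != 0) || (l != 0)); first exact: cintegral_mono.
rewrite negb_or !negbK => /andP[/eqP -> /eqP ->].
rewrite cintegralZ; last first.
  split; [exact: integrable_cos_phase|exact: integrable_sin_phase].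
have -> : deriv_symbol e 0 0 = 0 by rewrite /deriv_symbol /phase !mul0r addr0 mulr0.
by rewrite !mul0r.
Qed.

End Integrals.

(** * The bilinear pairing, the projection and the Helmholtz operator *)

Section Galerkin.
Context {R : realType}.
Implicit Types (f g : scalar_field R) (p e : (R * R)%type) (k l : int).

Local Notation C := (real_complex R).

Lemma lowfreq0 N : lowfreq N 0 0.
Proof. by split; rewrite normr0. Qed.

Lemma trig_low0 N : @trig R (lowfreq N) (fun=> 0).
Proof.
have := trig_mono (0 : R[i]) (lowfreq0 N); congr trig.
by apply/funext => p; rewrite mul0r.
Qed.

(** This passes between the coefficient matrices that define [S_N] and the inductive description; a
    single mode corresponds to a multiple of an elementary matrix. *)
Lemma SN_trig N f : SN N f <-> trig (lowfreq N) f.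
Proof.
split=> [[M Mf]|].
  have -> : f = fun p => \sum_i \sum_j M i j * fourier (i%:Z - N%:Z) (j%:Z - N%:Z) p.
    exact/funext.
  apply: trig_sum => [|i]; first exact: trig_low0.
  apply: (@trig_sum _ _ _ (fun j p => M i j * fourier (i%:Z - N%:Z) (j%:Z - N%:Z) p)).
    exact: trig_low0.
  move=> j; apply: trig_mono; split.
    by have := ltn_ord i; lia.
  by have := ltn_ord j; lia.
elim=> [c k l [kN lN]|f1 f2 _ [M1 E1] _ [M2 E2]]; last first.
  exists (M1 + M2) => p; rewrite E1 E2 -big_split; apply: eq_bigr => i _ /=.
  by rewrite -big_split; apply: eq_bigr => j _; rewrite mxE mulrDl.
(* The frequency [k] sits at the index [k + N], which lies between 0 and [2 * N]; [absz] only turns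
   this nonnegative integer into a natural number. *)
have ltk : (absz (k + N%:Z)%R < (2 * N).+1)%N by lia.
have hl : (absz (l + N%:Z)%R < (2 * N).+1)%N by lia.
exists (c *: delta_mx (Ordinal ltk) (Ordinal hl)) => p.
rewrite (bigD1 (Ordinal ltk)) //= (bigD1 (Ordinal hl)) //= !mxE !eqxx /= mulr1.
rewrite [X in _ = _ + X + _]big1 => [|j jl]; last first.
  by rewrite !mxE (negPf jl) andbF mulr0 mul0r.
rewrite [X in _ = _ + X]big1 => [|i ik]; last first.
  by apply: big1 => j _; rewrite !mxE (negPf ik) mulr0 mul0r.
rewrite !addr0; congr (_ * fourier _ _ _); lia.
Qed.

(* Locked for the same reason as [pd]. *)
Definition pairing : scalar_field R -> scalar_field R -> R[i] :=
  locked (fun f g => cintegral (fun p => f p * g p)).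

Lemma pairingE f g : pairing f g = cintegral (fun p => f p * g p).
Proof. by rewrite /pairing -lock. Qed.

Lemma pairingC f g : pairing f g = pairing g f.
Proof. by rewrite !pairingE; congr cintegral; apply/funext => p; rewrite mulrC. Qed.

Lemma pairingDl f g h : trig anyfreq f -> trig anyfreq g -> trig anyfreq h ->
  pairing (fun p => f p + g p) h = pairing f h + pairing g h.
Proof.
move=> tf tg th; rewrite !pairingE -cintegralD; try exact/trig_cintegrable/trig_mul.
by congr cintegral; apply/funext => p; rewrite mulrDl.
Qed.

Lemma pairingDr f g h : trig anyfreq f -> trig anyfreq g -> trig anyfreq h ->
  pairing h (fun p => f p + g p) = pairing h f + pairing h g.
Proof.
move=> tf tg th; rewrite (pairingC h f) (pairingC h g) -(pairingDl tf tg th).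
exact: pairingC.
Qed.

Lemma pairingZl a f h : trig anyfreq f -> trig anyfreq h ->
  pairing (fun p => a * f p) h = a * pairing f h.
Proof.
move=> tf th; rewrite !pairingE -cintegralZ; last exact/trig_cintegrable/trig_mul.
by congr cintegral; apply/funext => p; rewrite mulrA.
Qed.

Lemma pairingBl f g h : trig anyfreq f -> trig anyfreq g -> trig anyfreq h ->
  pairing (fun p => f p - g p) h = pairing f h - pairing g h.
Proof.
move=> tf tg th.
rewrite (_ : (fun p => f p - g p) = fun p => f p + (-1) * g p); last first.
  by apply/funext => p; rewrite mulN1r.
by rewrite pairingDl ?pairingZl ?mulN1r//; exact: trig_scale.
Qed.

(** Integration by parts: the derivative of the product [f g] has integral zero. *)
Lemma pairing_pd e f g : trig anyfreq f -> trig anyfreq g ->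
  pairing (pd e f) g = - pairing f (pd e g).
Proof.
move=> tf tg; apply/eqP; rewrite -addr_eq0; apply/eqP.
rewrite !pairingE -cintegralD; try by apply/trig_cintegrable/trig_mul => //; exact: trig_pd.
rewrite -(@cintegral_pd _ e (fun p => f p * g p)); last exact: trig_mul.
by rewrite pdM.
Qed.

Definition laplace f : scalar_field R :=
  fun p => pd (1, 0) (pd (1, 0) f) p + pd (0, 1) (pd (0, 1) f) p.

Lemma lap_laplace : lap = laplace.
Proof. by rewrite /lap /dx /dy partial_pd. Qed.

Lemma trig_laplace P f : trig P f -> trig P (laplace f).
Proof.
move=> t; apply: trig_add; apply: trig_pd; exact: trig_pd.
Qed.

Lemma pairing_pd2 e f g : trig anyfreq f -> trig anyfreq g ->
  pairing (pd e (pd e f)) g = pairing (pd e (pd e g)) f.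
Proof.
move=> tf tg; have tp h := @trig_pd R anyfreq e h.
rewrite (pairing_pd e (tp f tf) tg) (pairing_pd e (tp g tg) tf).
by congr (- _); exact: pairingC.
Qed.

Lemma pairing_laplace f g : trig anyfreq f -> trig anyfreq g ->
  pairing (laplace f) g = pairing (laplace g) f.
Proof.
move=> tf tg; have t2 e h : trig anyfreq h -> trig anyfreq (pd e (pd e h)).
  by move=> th; exact/trig_pd/trig_pd.
apply: etrans (pairingDl (t2 (1, 0) f tf) (t2 (0, 1) f tf) tg) _.
apply: etrans _ (esym (pairingDl (t2 (1, 0) g tg) (t2 (0, 1) g tg) tf)).
exact: congr2 (pairing_pd2 (1, 0) tf tg) (pairing_pd2 (0, 1) tf tg).
Qed.

(* A high frequency is orthogonal to every low one, so the projection drops it. *)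
Lemma trig_proj N f : trig anyfreq f -> exists2 g, trig (lowfreq N) g &
  forall h, trig (lowfreq N) h -> pairing g h = pairing f h.
Proof.
elim=> [c k l _|f1 f2 t1 [g1 s1 E1] t2 [g2 s2 E2]]; last first.
  exists (fun p => g1 p + g2 p); first exact: trig_add.
  move=> h th; have th' := trigW th.
  rewrite (pairingDl (trigW s1) (trigW s2) th') (pairingDl t1 t2 th').
  by rewrite (E1 h th) (E2 h th).
have [low|high] := pselect (lowfreq N k l).
  by exists (fun p => c * fourier k l p) => //; exact: trig_mono.
exists (fun=> 0); first exact: trig_low0.
move=> h th.
rewrite (_ : pairing (fun=> 0) h = 0); last first.
  rewrite pairingE (_ : (fun p => 0 * h p) = fun p => 0 * fourier 0 0 p); last first.
    by apply/funext => p; rewrite !mul0r.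
  rewrite cintegralZ ?mul0r//.
  have := trig_cst (1 : R[i]) => /trig_cintegrable; congr cintegrable.
  by apply/funext => p; rewrite fourier0.
apply/esym; elim: th => [c' k' l' low|h1 h2 s1 E1 s2 E2]; last first.
  have tm : trig anyfreq (fun p => c * fourier k l p) by exact: trig_mono.
  by rewrite (pairingDr (trigW s1) (trigW s2) tm) E1 E2 addr0.
rewrite pairingE (_ : (fun p => _) = fun p => c * c' * fourier (k + k') (l + l') p).
  (* The pairing has no conjugation, so the product of two modes has nonzero mean only for opposite
     frequencies. Low frequencies are stable under negation, so this would make [(k, l)] low. *)
  apply: cintegral_mono; rewrite -negb_and; apply/negP => /andP[/eqP kk /eqP ll].
  apply: high; case: low => lk ll'.
  have -> : k = - k' by lia.
  have -> : l = - l' by lia.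
  by split; rewrite normrN.
by apply/funext => p; rewrite -fourierM; ring.
Qed.

Lemma laplaceD f g : trig anyfreq f -> trig anyfreq g ->
  laplace (fun p => f p + g p) = fun p => laplace f p + laplace g p.
Proof.
move=> tf tg.
have D e : pd e (pd e (fun p => f p + g p)) =
    fun p => pd e (pd e f) p + pd e (pd e g) p.
  by rewrite (pdD e tf tg) (pdD e (trig_pd e tf) (trig_pd e tg)).
apply/funext => p.
have /(congr1 (fun h => h p)) E1 := D (1, 0).
have /(congr1 (fun h => h p)) E2 := D (0, 1).
by rewrite /laplace; apply: etrans (congr2 +%R E1 E2) _; rewrite addrACA.
Qed.

(** The multiplier of the Laplacian is the sum of the squares of [2 pi i k] and [2 pi i l]. *)
Lemma laplace_mono c k l : laplace (fun p => c * fourier k l p) =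
  fun p => - C ((2 * pi) ^+ 2 * (k%:~R ^+ 2 + l%:~R ^+ 2)) * c * fourier k l p.
Proof.
rewrite /laplace !pd_mono; apply/funext => p.
have -> : - C ((2 * pi) ^+ 2 * (k%:~R ^+ 2 + l%:~R ^+ 2)) =
   deriv_symbol (1, 0) k l * deriv_symbol (1, 0) k l +
   deriv_symbol (0, 1) k l * deriv_symbol (0, 1) k l.
  apply/eqP; rewrite eq_complex /= /phase /=; apply/andP; split; apply/eqP; ring.
by ring.
Qed.

(** * The Helmholtz operator on trigonometric polynomials *)

Definition helmholtz (b : R) f : scalar_field R := fun p => f p - C b * laplace f p.

Lemma trig_helmholtz P b f : trig P f -> trig P (helmholtz b f).
Proof. by move=> tf; apply: trig_sub => //; apply/trig_scale/trig_laplace. Qed.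

(** On each mode the operator multiplies by a real number [m], at least 1 because [b] is
    nonnegative, so the coefficients can be divided by it. No frequency is added: preimages of
    elements of [S_N] stay in [S_N] and may serve as test functions. *)
Lemma helmholtz_surj P b f : 0 <= b -> trig P f ->
  exists2 g, trig P g & helmholtz b g = f.
Proof.
move=> b0; elim=> [c k l Pkl|f1 f2 t1 [g1 s1 E1] t2 [g2 s2 E2]]; last first.
  exists (fun p => g1 p + g2 p); first exact: trig_add.
  rewrite /helmholtz laplaceD; [|exact: trigW s1|exact: trigW s2].
  by rewrite -E1 -E2 /helmholtz; apply/funext => p; ring.
pose m : R := 1 + b * ((2 * pi) ^+ 2 * (k%:~R ^+ 2 + l%:~R ^+ 2)).
have m0 : C m != 0.
  rewrite fmorph_eq0 gt_eqF// ltr_pwDl// mulr_ge0//.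
  by rewrite mulr_ge0// ?addr_ge0 ?sqr_ge0.
exists (fun p => (c / C m) * fourier k l p); first exact: trig_mono.
rewrite /helmholtz laplace_mono; apply/funext => p.
rewrite [RHS](_ : _ = C m * (c / C m) * fourier k l p); last first.
  by rewrite [C m * _]mulrC divfK.
by rewrite /m rmorphD rmorph1 rmorphM; ring.
Qed.

Lemma pairing_helmholtz b f g : trig anyfreq f -> trig anyfreq g ->
  pairing (helmholtz b f) g = pairing f (helmholtz b g).
Proof.
move=> tf tg; have tl h := @trig_laplace anyfreq h.
have ts h : trig anyfreq h -> trig anyfreq (fun p => C b * laplace h p).
  by move=> th; exact/trig_scale/tl.
rewrite [RHS]pairingC /helmholtz (pairingBl tf (ts f tf) tg) (pairingBl tg (ts g tg) tf).
rewrite (pairingZl _ (tl f tf) tg) (pairingZl _ (tl g tg) tf) (pairing_laplace tf tg).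
by rewrite (pairingC f g).
Qed.

(** Both operators are Fourier multipliers, hence commute. *)
Lemma pd_helmholtz b e f : trig anyfreq f ->
  pd e (helmholtz b f) = helmholtz b (pd e f).
Proof.
elim=> [c k l _|f1 f2 t1 IH1 t2 IH2].
  rewrite /helmholtz laplace_mono pd_mono laplace_mono.
  set s := - C _.
  rewrite (_ : (fun p => _ - _) =
    fun p => (c - C b * s * c) * fourier k l p); last first.
    by apply/funext => p; ring.
  rewrite pd_mono; apply/funext => p; ring.
have hD g1 g2 : trig anyfreq g1 -> trig anyfreq g2 ->
  helmholtz b (fun p => g1 p + g2 p) = fun p => helmholtz b g1 p + helmholtz b g2 p.
  by move=> s1 s2; rewrite /helmholtz laplaceD//; apply/funext => p; ring.
have tp g := @trig_pd R anyfreq e g.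
have th g := @trig_helmholtz anyfreq b g.
by rewrite hD// pdD; [|exact: th..]; rewrite IH1 IH2 pdD// hD//; exact: tp.
Qed.

End Galerkin.

(** * The rate of change of the energy *)

Section Conservation.
Context {R : realType}.
Implicit Types (f g h : scalar_field R) (p e : (R * R)%type) (k l : int).

Local Notation C := (real_complex R).

(** The cancellation in abstract form: it uses only the skew coupling of the two weak equations
    through [F0] and [(G10, G20)], whatever these trigonometric polynomials are. *)
Lemma helmholtz_rate_eq0 N b e1 e2 (F0 G10 G20 z' w1 w2 : scalar_field R) :
  0 <= b ->
  trig anyfreq F0 -> trig anyfreq G10 -> trig anyfreq G20 ->
  trig (lowfreq N) z' -> trig (lowfreq N) w1 -> trig (lowfreq N) w2 ->
  (forall psi, trig (lowfreq N) psi ->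
    pairing (helmholtz b z') psi = pairing G10 (pd e1 psi) + pairing G20 (pd e2 psi)) ->
  (forall psi1 psi2, trig (lowfreq N) psi1 -> trig (lowfreq N) psi2 ->
    pairing (helmholtz b w1) psi1 + pairing (helmholtz b w2) psi2 =
    pairing F0 (pd e1 psi1) + pairing F0 (pd e2 psi2)) ->
  pairing F0 z' + (pairing G10 w1 + pairing G20 w2) = 0.
Proof.
move=> b0 tF0 tG10 tG20 tz tw1 tw2 mass momentum.
have [F tF FE] := trig_proj N tF0.
have [G1 tG1 G1E] := trig_proj N tG10.
have [G2 tG2 G2E] := trig_proj N tG20.
have [psi tpsi psiE] := helmholtz_surj b0 tF.
have [Psi1 tPsi1 Psi1E] := helmholtz_surj b0 tG1.
have [Psi2 tPsi2 Psi2E] := helmholtz_surj b0 tG2.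
have tp e h : trig (lowfreq N) h -> trig (lowfreq N) (pd e h) by exact: trig_pd.
have W h : trig (lowfreq N) h -> trig anyfreq h by exact: trigW.
have H f g : trig (lowfreq N) f -> trig (lowfreq N) g ->
    pairing (helmholtz b f) g = pairing (helmholtz b g) f.
  by move=> tf tg; rewrite (pairing_helmholtz b (W f tf) (W g tg)) pairingC.
(* The time derivatives are low, so each gradient may be replaced by its projection, which is then
   written as the image of a test function under the Helmholtz operator. *)
rewrite -(FE _ tz) -(G1E _ tw1) -(G2E _ tw2) -psiE -Psi1E -Psi2E.
rewrite (H psi z' tpsi tz) (H Psi1 w1 tPsi1 tw1) (H Psi2 w2 tPsi2 tw2).
rewrite (mass psi tpsi) (momentum Psi1 Psi2 tPsi1 tPsi2).
(* Derivatives of the test functions are low as well, so projections may be inserted on the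
   right-hand sides too. *)
rewrite -(G1E _ (tp e1 psi tpsi)) -(G2E _ (tp e2 psi tpsi)).
rewrite -(FE _ (tp e1 Psi1 tPsi1)) -(FE _ (tp e2 Psi2 tPsi2)).
rewrite -Psi1E -Psi2E.
(* The operator is moved onto [pd e psi], commuted with the derivative and absorbed into [F];
   integration by parts then gives the opposite of the term coming from the momentum equation. *)
have K e f : trig (lowfreq N) f ->
    pairing (helmholtz b f) (pd e psi) = - pairing F (pd e f).
  move=> tf; rewrite (pairing_helmholtz b (W f tf) (W _ (tp e psi tpsi))).
  rewrite -(pd_helmholtz b e (W psi tpsi)) psiE pairingC.
  by rewrite (pairing_pd e (W F tF) (W f tf)).
by rewrite (K e1 Psi1 tPsi1) (K e2 Psi2 tPsi2) addrACA !addNr addr0.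
Qed.

(** Three terms is the common shape of [dH_zeta] and [dH_vel] below. *)
Lemma pairing_lin3 x y w f g h psi :
  trig anyfreq f -> trig anyfreq g -> trig anyfreq h -> trig anyfreq psi ->
  pairing (fun p => x * f p + y * g p + w * h p) psi =
  x * pairing f psi + y * pairing g psi + w * pairing h psi.
Proof.
move=> tf tg th tpsi; have S (a : R[i]) u : trig anyfreq u -> trig anyfreq (fun p => a * u p).
  exact: trig_scale.
rewrite (pairingDl (trig_add (S x f tf) (S y g tg)) (S w h th) tpsi).
rewrite (pairingDl (S x f tf) (S y g tg) tpsi).
by rewrite (pairingZl x tf tpsi) (pairingZl y tg tpsi) (pairingZl w th tpsi).
Qed.

Lemma trig_lin3 x y w f g h :
  trig anyfreq f -> trig anyfreq g -> trig anyfreq h ->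
  trig anyfreq (fun p => x * f p + y * g p + w * h p).
Proof.
move=> tf tg th; apply: trig_add; last exact: trig_scale.
by apply: trig_add; exact: trig_scale.
Qed.

Lemma pd_lin3 e x y w f g h :
  trig anyfreq f -> trig anyfreq g -> trig anyfreq h ->
  pd e (fun p => x * f p + y * g p + w * h p) =
  fun p => x * pd e f p + y * pd e g p + w * pd e h p.
Proof.
move=> tf tg th; have S (a : R[i]) u : trig anyfreq u -> trig anyfreq (fun p => a * u p).
  exact: trig_scale.
rewrite (pdD e (trig_add (S x f tf) (S y g tg)) (S w h th)).
rewrite (pdD e (S x f tf) (S y g tg)).
by rewrite (pdZ e x tf) (pdZ e y tg) (pdZ e w th).
Qed.

Lemma laplace_pd e f : trig anyfreq f -> laplace (pd e f) = pd e (laplace f).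
Proof.
move=> tf; have tp e' := trig_pd e' tf.
have t2 e' : trig anyfreq (pd e' (pd e' f)) by exact/trig_pd/tp.
rewrite /laplace (pdD e (t2 (1, 0)) (t2 (0, 1))).
have D e' : pd e (pd e' (pd e' f)) = pd e' (pd e' (pd e f)).
  by rewrite (pdC e e' (tp e')) (pdC e e' tf).
by rewrite !D.
Qed.

Lemma inner_conj f psi : inner f (fun p => (psi p)^*) = pairing f psi.
Proof.
rewrite pairingE; congr cintegral; apply/funext => p.
by rewrite conjCK.
Qed.

(** The conjugate of [psi] is a legitimate test function and undoes the conjugation in [inner]. The
    conclusion equates functionals, so a whole Galerkin equation is converted by one rewriting. *)
Lemma bilinear_test N (psi : scalar_field R) : trig (lowfreq N) psi ->
  exists2 phi, SN N phi & inner^~ phi = pairing^~ psi.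
Proof.
move=> tpsi; exists (fun p => (psi p)^*); first exact/SN_trig/trig_conj.
by apply/funext => f; exact: inner_conj.
Qed.

Section Rate.
Variables (N : nat) (a b c gamma delta : R).
Hypothesis b0 : 0 <= b.
Variables (z z' : scalar_field R) (v v' : vector_field R).
Hypotheses (tz : trig (lowfreq N) z) (tz' : trig (lowfreq N) z').
Hypotheses (tv1 : trig (lowfreq N) v.1) (tv2 : trig (lowfreq N) v.2).
Hypotheses (tv1' : trig (lowfreq N) v'.1) (tv2' : trig (lowfreq N) v'.2).
Hypothesis mass : forall phi, SN N phi ->
  mass_eq a b gamma delta z z' v phi.
Hypothesis momentum : forall chi, SN N chi.1 -> SN N chi.2 ->
  momentum_eq c b gamma delta z v v' chi.

Let ex : (R * R)%type := (1, 0).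
Let ey : (R * R)%type := (0, 1).
Let r1C := C (r1 gamma delta).
Let r2C := C (r2 gamma).
Let lC := C (lambda gamma delta).
Let cC := C (c' gamma c).

(* Half the variational derivatives of the energy in [zeta] and in a component
   [u] of the velocity. *)
Definition dH_zeta : scalar_field R :=
  fun p => r2C * z p + C (lambda gamma delta / 2) * (v.1 p * v.1 p + v.2 p * v.2 p)
           + cC * laplace z p.
Definition dH_vel (u : scalar_field R) : scalar_field R :=
  fun p => r1C * u p + lC * (z p * u p) + C a * laplace u p.

Let Tz := trigW tz.
Let Tv1 := trigW tv1.
Let Tv2 := trigW tv2.
Let Tz' := trigW tz'.
Let Tv1' := trigW tv1'.
Let Tv2' := trigW tv2'.
Let Tsq := trig_add (trig_mul Tv1 Tv1) (trig_mul Tv2 Tv2).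

Lemma trig_dH_zeta : trig anyfreq dH_zeta.
Proof. exact: (trig_lin3 _ _ _ Tz Tsq (trig_laplace Tz)). Qed.

Lemma trig_dH_vel u : trig anyfreq u -> trig anyfreq (dH_vel u).
Proof. by move=> tu; exact: (trig_lin3 _ _ _ tu (trig_mul Tz tu) (trig_laplace tu)). Qed.

(** The mass equation says that [helmholtz b z'] is, against test functions, minus the divergence of
    [(dH_vel v.1, dH_vel v.2)]; the divergence is then moved onto [psi]. *)
Lemma weak_mass psi : trig (lowfreq N) psi ->
  pairing (helmholtz b z') psi =
  pairing (dH_vel v.1) (pd ex psi) + pairing (dH_vel v.2) (pd ey psi).
Proof.
move=> tpsi; have Tpsi := trigW tpsi.
have IBP e u : trig anyfreq u -> pairing (dH_vel u) (pd e psi) =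
  - (r1C * pairing (pd e u) psi + lC * pairing (pd e (fun p => z p * u p)) psi
     + C a * pairing (laplace (pd e u)) psi).
  move=> tu; apply: oppr_inj; rewrite opprK.
  rewrite -(pairing_pd e (trig_dH_vel tu) Tpsi).
  rewrite (pd_lin3 e _ _ _ tu (trig_mul Tz tu) (trig_laplace tu)) -(laplace_pd e tu).
  have tp u' : trig anyfreq u' -> trig anyfreq (pd e u') by exact: trig_pd.
  exact: (pairing_lin3 _ _ _ (tp u tu) (tp _ (trig_mul Tz tu)) (trig_laplace (tp u tu)) Tpsi).
rewrite (IBP ex v.1 Tv1) (IBP ey v.2 Tv2).
have [phi sphi innerE] := bilinear_test tpsi.
pose B := inner^~ phi.
(* The equation is restated through the functional [B], which can then be replaced by the bilinear
   pairing everywhere at once. *)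
have : B z' + r1C * B (div v) + lC * B (div (fscale z v)) + C a * B (lap (div v))
       - C b * B (lap z') = 0 := mass sphi.
have -> : B = pairing^~ psi by exact: innerE.
cbv beta; rewrite lap_laplace /div /fscale /dx /dy partial_pd /fst /snd -/ex -/ey.
have tp e u : trig anyfreq u -> trig anyfreq (pd e u) by exact: trig_pd.
rewrite (laplaceD (tp ex _ Tv1) (tp ey _ Tv2)).
rewrite (pairingDl (tp ex _ Tv1) (tp ey _ Tv2) Tpsi).
rewrite (pairingDl (tp ex _ (trig_mul Tz Tv1)) (tp ey _ (trig_mul Tz Tv2)) Tpsi).
rewrite (pairingDl (trig_laplace (tp ex _ Tv1)) (trig_laplace (tp ey _ Tv2)) Tpsi).
rewrite (pairingBl Tz' (trig_scale (C b) (trig_laplace Tz')) Tpsi).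
rewrite (pairingZl (C b) (trig_laplace Tz') Tpsi).
move=> E; apply/eqP; rewrite -subr_eq0 -E; apply/eqP.
by rewrite /r1C /lC; ring.
Qed.

(** Likewise the momentum equation says that the Helmholtz operator applied to [v'] is, against test
    fields, minus the gradient of [dH_zeta]. *)
Lemma weak_momentum psi1 psi2 : trig (lowfreq N) psi1 -> trig (lowfreq N) psi2 ->
  pairing (helmholtz b v'.1) psi1 + pairing (helmholtz b v'.2) psi2 =
  pairing dH_zeta (pd ex psi1) + pairing dH_zeta (pd ey psi2).
Proof.
move=> tpsi1 tpsi2; have Tpsi1 := trigW tpsi1; have Tpsi2 := trigW tpsi2.
have IBP e psi : trig anyfreq psi -> pairing dH_zeta (pd e psi) =
  - (r2C * pairing (pd e z) psi
     + C (lambda gamma delta / 2) *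
       pairing (pd e (fun p => v.1 p * v.1 p + v.2 p * v.2 p)) psi
     + cC * pairing (laplace (pd e z)) psi).
  move=> Tpsi; apply: oppr_inj; rewrite opprK.
  rewrite -(pairing_pd e trig_dH_zeta Tpsi).
  rewrite (pd_lin3 e _ _ _ Tz Tsq (trig_laplace Tz)) -(laplace_pd e Tz).
  have tp u : trig anyfreq u -> trig anyfreq (pd e u) by exact: trig_pd.
  exact: (pairing_lin3 _ _ _ (tp z Tz) (tp _ Tsq) (trig_laplace (tp z Tz)) Tpsi).
rewrite (IBP ex psi1 Tpsi1) (IBP ey psi2 Tpsi2).
have sqE : sqn v = fun p => v.1 p * v.1 p + v.2 p * v.2 p by [].
have [phi1 sphi1 inner1E] := bilinear_test tpsi1.
have [phi2 sphi2 inner2E] := bilinear_test tpsi2.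
pose B1 := inner^~ phi1; pose B2 := inner^~ phi2.
have : (B1 v'.1 + B2 v'.2) + r2C * (B1 (dx z) + B2 (dy z))
       + C (lambda gamma delta / 2) * (B1 (dx (sqn v)) + B2 (dy (sqn v)))
       + cC * (B1 (lap (dx z)) + B2 (lap (dy z)))
       - C b * (B1 (lap v'.1) + B2 (lap v'.2)) = 0 := @momentum (phi1, phi2) sphi1 sphi2.
have -> : B1 = pairing^~ psi1 by exact: inner1E.
have -> : B2 = pairing^~ psi2 by exact: inner2E.
cbv beta; rewrite sqE lap_laplace /dx /dy partial_pd -/ex -/ey.
rewrite (pairingBl Tv1' (trig_scale (C b) (trig_laplace Tv1')) Tpsi1).
rewrite (pairingBl Tv2' (trig_scale (C b) (trig_laplace Tv2')) Tpsi2).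
rewrite (pairingZl (C b) (trig_laplace Tv1') Tpsi1) (pairingZl (C b) (trig_laplace Tv2') Tpsi2).
move=> E; apply/eqP; rewrite -subr_eq0 -E; apply/eqP.
by rewrite /r2C /cC; ring.
Qed.

Lemma rate_pairing_eq0 : pairing dH_zeta z' +
  (pairing (dH_vel v.1) v'.1 + pairing (dH_vel v.2) v'.2) = 0.
Proof.
exact: (helmholtz_rate_eq0 b0 trig_dH_zeta (trig_dH_vel Tv1) (trig_dH_vel Tv2)
  tz' tv1' tv2' weak_mass weak_momentum).
Qed.

(** The polar form of [sqn (grad f)], bilinear and without conjugation. *)
Definition grad_dot f g : scalar_field R :=
  fun p => pd ex f p * pd ex g p + pd ey f p * pd ey g p.

Lemma cintegral_grad_dot f g : trig anyfreq f -> trig anyfreq g ->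
  cintegral (grad_dot f g) = - pairing (laplace f) g.
Proof.
move=> tf tg; have tp e u : trig anyfreq u -> trig anyfreq (pd e u) by exact: trig_pd.
have t2 e : trig anyfreq (pd e (pd e f)) by exact/tp/tp.
have E : pairing (laplace f) g =
    pairing (pd ex (pd ex f)) g + pairing (pd ey (pd ey f)) g.
  exact: (pairingDl (t2 ex) (t2 ey) tg).
rewrite E (pairing_pd ex (tp ex f tf) tg) (pairing_pd ey (tp ey f tf) tg).
rewrite -opprD opprK !pairingE -cintegralD //.
  exact/trig_cintegrable/trig_mul/tp/tg/tp.
exact/trig_cintegrable/trig_mul/tp/tg/tp.
Qed.

(** The integrand is the time derivative of the energy density as given by the product rule.
    Integrating the gradient terms by parts turns its integral into twice the sum in
    [rate_pairing_eq0]. *)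
Lemma energy_rate :
  cintegral (fun p =>
    - cC * (2 * grad_dot z z' p)
    - C a * (2 * (grad_dot v.1 v'.1 p + grad_dot v.2 v'.2 p))
    + (lC * z' p * (v.1 p ^+ 2 + v.2 p ^+ 2)
       + (r1C + lC * z p) * (2 * (v.1 p * v'.1 p + v.2 p * v'.2 p)))
    + r2C * (2 * (z p * z' p))) = 0.
Proof.
have tp e u : trig anyfreq u -> trig anyfreq (pd e u) by exact: trig_pd.
have tgd f g : trig anyfreq f -> trig anyfreq g -> trig anyfreq (grad_dot f g).
  by move=> tf tg; apply: trig_add; apply: trig_mul; exact: tp.
(* The integrand is the sum of 2 F0 zeta_t and 2 G0 . v_t up to divergences. *)
have I (x : R) f u u' : trig anyfreq f -> trig anyfreq u -> trig anyfreq u' ->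
    cintegral (fun p => 2 * (f p * u' p) - 2 * C x * (laplace u p * u' p)
                        - 2 * C x * grad_dot u u' p) = 2 * pairing f u'.
  move=> tf tu tu'; have tl := trig_laplace tu.
  have Ci h : trig anyfreq h -> cintegrable h by exact: trig_cintegrable.
  have tm := trig_mul tf tu'; have tlm := trig_mul tl tu'.
  have Sc y h : trig anyfreq h -> trig anyfreq (fun p => y * h p) by exact: trig_scale.
  have E : (fun p => 2 * (f p * u' p) - 2 * C x * (laplace u p * u' p)
                     - 2 * C x * grad_dot u u' p) =
      fun p => (2 * (f p * u' p) + - (2 * C x) * (laplace u p * u' p))
               + - (2 * C x) * grad_dot u u' p.
    by apply/funext => p; rewrite !mulNr.
  rewrite E (cintegralD (Ci _ (trig_add (Sc _ _ tm) (Sc _ _ tlm)))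
    (Ci _ (Sc _ _ (tgd _ _ tu tu')))).
  rewrite (cintegralD (Ci _ (Sc _ _ tm)) (Ci _ (Sc _ _ tlm))).
  rewrite (cintegralZ _ (Ci _ tm)) (cintegralZ _ (Ci _ tlm)) (cintegralZ _ (Ci _ (tgd _ _ tu tu'))).
  by rewrite (cintegral_grad_dot tu tu') !pairingE; ring.
have Iz := I (c' gamma c) _ _ _ trig_dH_zeta Tz Tz'.
have I1 := I a _ _ _ (trig_dH_vel Tv1) Tv1 Tv1'.
have I2 := I a _ _ _ (trig_dH_vel Tv2) Tv2 Tv2'.
have Ci x f u u' : trig anyfreq f -> trig anyfreq u -> trig anyfreq u' ->
    cintegrable (fun p => 2 * (f p * u' p) - 2 * C x * (laplace u p * u' p)
                        - 2 * C x * grad_dot u u' p).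
  move=> tf tu tu'; apply: trig_cintegrable; apply: trig_sub.
    by apply: trig_sub; apply: trig_scale; apply: trig_mul => //; exact: trig_laplace.
  exact/trig_scale/tgd.
have Cz := Ci (c' gamma c) _ _ _ trig_dH_zeta Tz Tz'.
have C1 := Ci a _ _ _ (trig_dH_vel Tv1) Tv1 Tv1'.
have C2 := Ci a _ _ _ (trig_dH_vel Tv2) Tv2 Tv2'.
have E : 2 * (pairing dH_zeta z' +
   (pairing (dH_vel v.1) v'.1 + pairing (dH_vel v.2) v'.2)) = 0.
  by rewrite rate_pairing_eq0 mulr0.
rewrite -E !mulrDr -Iz -I1 -I2 -(cintegralD C1 C2) -(cintegralD Cz (cintegrableD C1 C2)).
(* The Laplacian terms now cancel pointwise against those inside [dH_zeta] and [dH_vel]. *)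
congr cintegral; apply/funext => p.
(* Writing [lC] through the embedded quotient leaves [ring] a single atom for the coefficient. *)
have half : C (lambda gamma delta / 2) * 2 = lC.
  by rewrite -(rmorph_nat (real_complex R)) -rmorphM divfK ?pnatr_eq0.
rewrite /dH_zeta /dH_vel -half /cC; ring.
Qed.

End Rate.
End Conservation.

(** * Time-dependent trigonometric polynomials *)

Section DerivativeWithin.
Local Open Scope classical_set_scope.
Context {R : realType}.
Variables (J : set R) (t : R).
Implicit Types (h g : R -> R) (x y : R).

Let F := within J (dnbhs t).

Lemma within_neq : \forall s \near F, s != t.
Proof. by apply: cvg_within; exact: withinT. Qed.

Lemma eq1_cvg h g x : h =1 g -> h s @[s --> F] --> x -> g s @[s --> F] --> x.
Proof. by move=> /funext ->. Qed.

Lemma near_cvg h g x : (\forall s \near F, h s = g s) ->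
  h s @[s --> F] --> x -> g s @[s --> F] --> x.
Proof.
move=> hg hx A /hx hA; have FF : Filter F by exact: within_filter.
by apply: filterS2 hg hA => s /= ->.
Qed.

Lemma has_derive_withinD h g x y :
  has_derive_within J h t x -> has_derive_within J g t y ->
  has_derive_within J (fun s => h s + g s) t (x + y).
Proof.
move=> hx gy; apply: eq1_cvg (cvgD hx gy) => s /=.
by rewrite -mulrDl; congr (_ / _); ring.
Qed.

Lemma has_derive_within_cst x : has_derive_within J (fun=> x) t 0.
Proof.
rewrite /has_derive_within.
under eq_fun do rewrite subrr mul0r.
exact: cvg_cst.
Qed.

(** For [s] other than [t], [h s] is [h t] plus the difference quotient times [s - t], and the last
    product tends to zero. *)
Lemma has_derive_within_cvg h x : has_derive_within J h t x -> h s @[s --> F] --> h t.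
Proof.
move=> hx.
have st : (s - t) @[s --> F] --> (0 : R).
  rewrite -(subrr t); apply: cvgB; last exact: cvg_cst.
  by move=> A At; exact: (cvg_within J (nbhs_dnbhs At)).
have -> : nbhs (h t) = nbhs (h t + x * 0) by rewrite mulr0 addr0.
apply: near_cvg (cvgD (cvg_cst (h t)) (cvgM hx st)); have FF : Filter F by exact: within_filter.
apply: filterS within_neq => s st0 /=.
by rewrite divfK ?subr_eq0// addrC subrK.
Qed.

(** The quotient of the product is [h t] times the quotient of [g] plus the quotient of [h] times
    [g s], and [g s] tends to [g t]. *)
Lemma has_derive_withinM h g x y :
  has_derive_within J h t x -> has_derive_within J g t y ->
  has_derive_within J (fun s => h s * g s) t (h t * y + x * g t).
Proof.
move=> hx gy; have gc := has_derive_within_cvg gy.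
apply: eq1_cvg (cvgD (cvgM (cvg_cst (h t)) gy) (cvgM hx gc)) => s /=.
by rewrite mulrA [_ / _ * g s]mulrAC -mulrDl; congr (_ / _); ring.
Qed.

(** The quotient reads the functions at points of [J] near [t] and also at [t] itself, hence the
    hypothesis [J t]. *)
Lemma eq_has_derive_within h g x : J t -> (forall s, J s -> h s = g s) ->
  has_derive_within J h t x -> has_derive_within J g t x.
Proof.
move=> Jt hg hx; apply: (near_cvg _ hx); have FF : Filter F by exact: within_filter.
have : \forall s \near F, J s by exact: withinT.
by apply: filterS => s Js; rewrite !hg.
Qed.

Lemma has_derive_within_unique h x y : ProperFilter F ->
  has_derive_within J h t x -> has_derive_within J h t y -> x = y.
Proof. by move=> PF hx hy; exact: (cvg_unique _ hx hy). Qed.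

Lemma has_derive_within_isolated h x : F set0 -> has_derive_within J h t x.
Proof.
by move=> F0 A _; apply: filterS F0 => s.
Qed.

Lemma dnbhs_within_proper : ~ F set0 -> ProperFilter F.
Proof. by move=> F0; apply: Build_ProperFilter. Qed.

(** * Complex-valued functions of time *)

Implicit Types (H G : R -> R[i]) (X Y : R[i]).

Lemma has_cderive_withinD H G X Y :
  has_cderive_within J H t X -> has_cderive_within J G t Y ->
  has_cderive_within J (fun s => H s + G s) t (X + Y).
Proof.
move=> [h1 h2] [g1 g2]; split; rewrite raddfD.
  by under eq_fun do rewrite raddfD; exact: has_derive_withinD.
by under eq_fun do rewrite raddfD; exact: has_derive_withinD.
Qed.

Lemma has_cderive_within_cst X : has_cderive_within J (fun=> X) t 0.
Proof. by split; exact: has_derive_within_cst. Qed.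

Lemma has_cderive_withinM H G X Y :
  has_cderive_within J H t X -> has_cderive_within J G t Y ->
  has_cderive_within J (fun s => H s * G s) t (H t * Y + X * G t).
Proof.
move=> [h1 h2] [g1 g2].
have N1 u x : has_derive_within J u t x -> has_derive_within J (fun s => - u s) t (- x).
  move=> ux; have := has_derive_withinM (has_derive_within_cst (-1)) ux.
  rewrite mul0r addr0 mulN1r; congr has_derive_within.
  by apply/funext => s; rewrite mulN1r.
split.
  have := has_derive_withinD (has_derive_withinM h1 g1) (N1 _ _ (has_derive_withinM h2 g2)).
  congr (has_derive_within _ _ _ _); last by rewrite [RHS]raddfD /= !Re_mulc; ring.
  by apply/funext => s; rewrite Re_mulc mulNr.
have := has_derive_withinD (has_derive_withinM h1 g2) (has_derive_withinM h2 g1).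
congr (has_derive_within _ _ _ _); last by rewrite [RHS]raddfD /= !Im_mulc; ring.
by apply/funext => s; rewrite Im_mulc.
Qed.

Lemma has_cderive_withinZ X H Y : has_cderive_within J H t Y ->
  has_cderive_within J (fun s => X * H s) t (X * Y).
Proof.
by move=> /(has_cderive_withinM (has_cderive_within_cst X)); rewrite mul0r addr0.
Qed.

Lemma has_cderive_within_sum (I : finType) (H : I -> R -> R[i]) (X : I -> R[i]) :
  (forall i, has_cderive_within J (H i) t (X i)) ->
  has_cderive_within J (fun s => \sum_i H i s) t (\sum_i X i).
Proof.
move=> HX; elim: index_enum => [|i r IH].
  by rewrite big_nil; under eq_fun do rewrite big_nil; exact: has_cderive_within_cst.
rewrite big_cons; under eq_fun do rewrite big_cons.
exact: has_cderive_withinD.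
Qed.

Lemma eq_has_cderive_within H G X : J t -> (forall s, J s -> H s = G s) ->
  has_cderive_within J H t X -> has_cderive_within J G t X.
Proof.
move=> Jt HG [h1 h2]; split.
  by apply: eq_has_derive_within h1 => // s Js; rewrite HG.
by apply: eq_has_derive_within h2 => // s Js; rewrite HG.
Qed.

Lemma has_cderive_within_unique H X Y : ProperFilter F ->
  has_cderive_within J H t X -> has_cderive_within J H t Y -> X = Y.
Proof.
move=> PF [h1 h2] [g1 g2]; apply/eqP; rewrite eq_complex.
by rewrite (has_derive_within_unique PF h1 g1) (has_derive_within_unique PF h2 g2) !eqxx.
Qed.

(* [tfam u u']: the [u s] are trigonometric polynomials of fixed frequencies whose
   coefficients are differentiable at [t] within [J], where [u] has time
   derivative [u']. *)
Inductive tfam : (R -> scalar_field R) -> scalar_field R -> Prop :=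
| tfam_mono G X k l : has_cderive_within J G t X ->
    tfam (fun s p => G s * fourier k l p) (fun p => X * fourier k l p)
| tfam_add u u' w w' : tfam u u' -> tfam w w' ->
    tfam (fun s p => u s p + w s p) (fun p => u' p + w' p).

Lemma tfam_trig u u' : tfam u u' -> (forall s, trig anyfreq (u s)) /\ trig anyfreq u'.
Proof.
elim=> [G X k l _|u1 u1' w w' _ [IH1 IH1'] _ [IH2 IH2']].
  by split=> [s|]; apply: trig_mono.
by split=> [s|]; apply: trig_add.
Qed.

Lemma eq_tfam u u' w w' : (forall s p, u s p = w s p) -> (forall p, u' p = w' p) ->
  tfam u u' -> tfam w w'.
Proof.
move=> uw uw'; have -> : u = w by apply/funext => s; apply/funext => p.
by have -> : u' = w' by apply/funext => p.
Qed.

Lemma tfam_cst X : tfam (fun _ _ => X) (fun=> 0).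
Proof.
apply: eq_tfam (tfam_mono 0 0 (has_cderive_within_cst X)) => [s p|p].
  by rewrite fourier0 mulr1.
by rewrite mul0r.
Qed.

Lemma tfam_mul u u' w w' : tfam u u' -> tfam w w' ->
  tfam (fun s p => u s p * w s p) (fun p => u t p * w' p + u' p * w t p).
Proof.
move=> tu tw; elim: tu => [G X k l HX|u1 u1' u2 u2' _ IH1 _ IH2]; last first.
  by apply: eq_tfam (tfam_add IH1 IH2) => *; ring.
elim: tw => [G2 X2 k2 l2 HX2|w1 w1' w2 w2' _ IH1 _ IH2]; last first.
  by apply: eq_tfam (tfam_add IH1 IH2) => *; ring.
apply: eq_tfam (tfam_mono (k + k2) (l + l2) (has_cderive_withinM HX HX2)) => *;
  rewrite -fourierM; ring.
Qed.

Lemma tfam_scale X u u' : tfam u u' -> tfam (fun s p => X * u s p) (fun p => X * u' p).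
Proof.
move=> /(tfam_mul (tfam_cst X)); apply: eq_tfam => // p.
by rewrite mul0r addr0.
Qed.

Lemma tfam_sum (I : finType) (u : I -> R -> scalar_field R) u' :
  (forall i, tfam (u i) (u' i)) ->
  tfam (fun s p => \sum_i u i s p) (fun p => \sum_i u' i p).
Proof.
move=> tu; elim: index_enum => [|i r IH].
  by apply: eq_tfam (tfam_cst 0) => *; rewrite big_nil.
by apply: eq_tfam (tfam_add (tu i) IH) => *; rewrite big_cons.
Qed.

(** Derivatives in time and space commute because [deriv_symbol] does not depend on time. *)
Lemma tfam_pd e u u' : tfam u u' -> tfam (fun s => pd e (u s)) (pd e u').
Proof.
elim=> [G X k l HX|u1 u1' u2 u2' t1 IH1 t2 IH2].
  apply: eq_tfam (tfam_mono k l (has_cderive_withinZ (deriv_symbol e k l) HX)) => *;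
    by rewrite pd_mono.
have [s1 s1'] := tfam_trig t1; have [s2 s2'] := tfam_trig t2.
by apply: eq_tfam (tfam_add IH1 IH2) => *; rewrite pdD.
Qed.

(** Differentiation under the integral sign without domination: the integral is a finite combination
    of the coefficients with weights constant in time. *)
Lemma tfam_cintegral u u' : tfam u u' ->
  has_cderive_within J (fun s => cintegral (u s)) t (cintegral u').
Proof.
have If k l : cintegrable (@fourier R k l).
  have := trig_cintegrable (@trig_mono R anyfreq 1 k l I); congr cintegrable.
  by apply/funext => p; rewrite mul1r.
elim=> [G X k l HX|u1 u1' u2 u2' t1 IH1 t2 IH2].
  rewrite (cintegralZ _ (If k l)) mulrC.
  have := has_cderive_withinZ (cintegral (fourier k l)) HX.
  congr has_cderive_within; apply/funext => s.
  by rewrite (cintegralZ _ (If k l)) mulrC.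
have [s1 s1'] := tfam_trig t1; have [s2 s2'] := tfam_trig t2.
rewrite (cintegralD (trig_cintegrable s1') (trig_cintegrable s2')).
have := has_cderive_withinD IH1 IH2; congr has_cderive_within; apply/funext => s.
by rewrite (cintegralD (trig_cintegrable (s1 s)) (trig_cintegrable (s2 s))).
Qed.

End DerivativeWithin.

(** * Discrete Fourier transform *)

Section DiscreteFourier.
Context {R : realType}.
Variable N : nat.
Let M := (2 * N).+1.

(** There are as many equispaced points in a period as frequencies from [-N] to [N]. *)
Definition grid (m : 'I_M) : R := m%:R / M%:R.

Lemma M_neq0 : M%:R != 0 :> R.
Proof. by rewrite pnatr_eq0. Qed.

(** Both factors use the first coordinate, so that sums along either axis of the grid reduce to
    [sum_grid]. *)
Lemma fourier_split k l (x y : R) :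
  fourier k l (x, y) = fourier k 0 (x, 0) * fourier l 0 (y, 0).
Proof.
have -> : fourier l 0 (y, 0 : R) = fourier 0 l (x, y).
  by rewrite /fourier /=; do ![congr Complex | congr cos | congr sin]; ring.
have -> : fourier k 0 (x, 0 : R) = fourier k 0 (x, y).
  by rewrite /fourier /=; do ![congr Complex | congr cos | congr sin]; ring.
by rewrite fourierM addr0 add0r.
Qed.

Lemma fourier_exp k n :
  fourier k 0 (M%:R^-1, 0 : R) ^+ n = fourier (k * n%:Z) 0 (M%:R^-1, 0).
Proof.
elim: n => [|n IH]; first by rewrite expr0 mulr0 fourier0.
by rewrite exprS IH fourierM addr0 intS mulrDr mulr1.
Qed.

Lemma fourier_grid k (m : 'I_M) :
  fourier k 0 (grid m, 0) = fourier k 0 (M%:R^-1, 0 : R) ^+ m.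
Proof.
rewrite fourier_exp /fourier /= /grid intrM.
by do ![congr Complex | congr cos | congr sin]; ring.
Qed.

(** If [exp (2 pi i k / M)] were 1, its real part would force [sin (pi k / M)] to vanish, while
    [pi |k| / M] lies strictly between 0 and [pi]. *)
Lemma fourier_neq1 k : k != 0 -> `|k| < M%:Z -> fourier k 0 (M%:R^-1, 0 : R) != 1.
Proof.
move=> k0 kM; apply/eqP => /(congr1 (@complex.Re R)).
rewrite /fourier /= mul0r addr0 => C1.
pose y : R := pi * (k%:~R / M%:R).
have yE : 2 * pi * (k%:~R / M%:R) = y *+ 2 by rewrite /y -mulr_natl; ring.
move: C1; rewrite yE cos_mulr2n => C1.
have S0 : sin y ^+ 2 = 0 by have := cos2Dsin2 y; move: C1; rewrite -mulr_natl; lra.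
pose z : R := pi * (`|k|%:~R / M%:R).
have Sz : sin z ^+ 2 = 0.
  rewrite -S0 /z /y; have [kp|kn] := ler0P k; last by [].
  by rewrite intrN mulNr mulrN sinN sqrrN.
have : 0 < sin z.
  apply: sin_gt0_pi; rewrite /z; apply/andP; split.
    apply: mulr_gt0; first exact: pi_gt0.
    by apply: divr_gt0; rewrite ?ltr0z ?normr_gt0 ?ltr0n.
  rewrite -[ltRHS]mulr1 ltr_pM2l ?pi_gt0// ltr_pdivrMr ?ltr0n// mul1r.
  by rewrite -[M%:R]/(M%:Z%:~R) ltr_int.
by move/eqP: Sz; rewrite sqrf_eq0 => /eqP ->; rewrite ltxx.
Qed.

(** For nonzero [k] this is a full geometric sum of powers of an [M]-th root of unity other than
    1. *)
Lemma sum_grid k : `|k| < M%:Z ->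
  \sum_m fourier k 0 (grid m, 0) = if k == 0 then M%:R else 0 :> R[i].
Proof.
move=> kM; case: eqP => [->|/eqP k0].
  under eq_bigr do rewrite fourier0.
  by rewrite sumr_const card_ord.
under eq_bigr do rewrite fourier_grid.
have z1 := fourier_neq1 k0 kM; set z := fourier _ _ _ in z1 *.
have zM : z ^+ M = 1.
  rewrite fourier_exp /fourier /=.
  have -> : 2 * pi * ((k * M)%:~R * M%:R^-1 + 0%:~R * 0) = 2 * pi * k%:~R + 0 :> R.
    by rewrite intrM mulfK ?M_neq0// mul0r !addr0.
  by rewrite cos_2piZ sin_2piZ cos0 sin0.
have := subrX1 z M; rewrite zM subrr => /esym/eqP.
by rewrite mulf_eq0 subr_eq0 (negPf z1) /= => /eqP.
Qed.

(** The index [i] stands for the frequency [i - N], and the kernel carries the opposite one. Only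
    finitely many point values of [f] enter. *)
Definition dft (f : scalar_field R) (i j : 'I_M) : R[i] :=
  M%:R^-1 * M%:R^-1 * \sum_m \sum_n
    fourier (N%:Z - i%:Z) (N%:Z - j%:Z) (grid m, grid n) * f (grid m, grid n).

(** Discrete orthogonality: two indices differ by less than [M], so distinct frequencies are not
    aliased on the grid. *)
Lemma dftK (A : 'M[R[i]]_M) (f : scalar_field R) :
  (forall p, f p = \sum_i \sum_j A i j * fourier (i%:Z - N%:Z) (j%:Z - N%:Z) p) ->
  forall i j, dft f i j = A i j.
Proof.
move=> fE i j.
pose S k : R[i] := \sum_m fourier k 0 (grid m, 0).
have SE (i1 i2 : 'I_M) : S (i1%:Z - i2%:Z) = if i1 == i2 then M%:R else 0.
  rewrite /S sum_grid; first by rewrite subr_eq0.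
  by have := ltn_ord i1; have := ltn_ord i2; lia.
have E : \sum_m \sum_n
    fourier (N%:Z - i%:Z) (N%:Z - j%:Z) (grid m, grid n) * f (grid m, grid n) =
    \sum_i' \sum_j' A i' j' * (S (i'%:Z - i%:Z) * S (j'%:Z - j%:Z)).
  transitivity (\sum_m \sum_n \sum_i' \sum_j' A i' j' *
     (fourier (i'%:Z - i%:Z) 0 (grid m, 0) * fourier (j'%:Z - j%:Z) 0 (grid n, 0))).
    apply: eq_bigr => m _; apply: eq_bigr => n _; rewrite fE mulr_sumr.
    apply: eq_bigr => i' _; rewrite mulr_sumr; apply: eq_bigr => j' _.
    rewrite mulrCA fourierM -fourier_split; congr (_ * fourier _ _ _); lia.
  under eq_bigr do rewrite exchange_big /=.
  rewrite exchange_big /=; apply: eq_bigr => i' _.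
  under eq_bigr do rewrite exchange_big /=.
  rewrite exchange_big /=; apply: eq_bigr => j' _.
  rewrite /S mulr_suml mulr_sumr; apply: eq_bigr => m _.
  by rewrite !mulr_sumr.
rewrite /dft E (bigD1 i) //= (bigD1 j) //= !SE !eqxx.
rewrite [X in _ * (_ + X + _)]big1 => [|j' /negPf jj]; last by rewrite SE jj !mulr0.
rewrite [X in _ * (_ + X)]big1 => [|i' /negPf ii]; last first.
  by apply: big1 => j' _; rewrite SE ii mul0r mulr0.
rewrite !addr0 mulrCA -mulrA [_^-1 * (_ * _)]mulrCA mulKf ?mulVf ?mulr1 ?pnatr_eq0//.
Qed.

(** Differentiability of [u] at each point of space passes to its Fourier coefficients through
    [dft]. The family is rebuilt as [w] because outside [J] nothing is known about [u]. *)
Lemma galerkin_tfam (J : set R) (t : R) (u : R -> scalar_field R) (u' : scalar_field R) :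
  J t -> ProperFilter (within J (dnbhs t)) ->
  (forall s, J s -> SN N (u s)) -> has_dt J u t u' ->
  trig (lowfreq N) u' /\
  exists2 w, tfam J t w u' & forall s, J s -> w s = u s.
Proof.
move=> Jt PF uN du.
pose w s : scalar_field R := fun p =>
  \sum_i \sum_j dft (u s) i j * fourier (i%:Z - N%:Z) (j%:Z - N%:Z) p.
pose w' : scalar_field R := fun p =>
  \sum_i \sum_j dft u' i j * fourier (i%:Z - N%:Z) (j%:Z - N%:Z) p.
have wu s : J s -> w s = u s.
  move=> /uN [A uA]; apply/funext => p; rewrite uA /w.
  by apply: eq_bigr => i _; apply: eq_bigr => j _; rewrite (dftK uA).
have ddft i j : has_cderive_within J (fun s => dft (u s) i j) t (dft u' i j).
  apply: has_cderive_withinZ; apply: has_cderive_within_sum => m.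
  apply: has_cderive_within_sum => n; apply: has_cderive_withinZ; exact: du.
have tw : tfam J t w w'.
  apply: (tfam_sum (u := fun i s p => \sum_j _)) => i.
  by apply: (tfam_sum (u := fun j s p => _ * _)) => j; exact: tfam_mono.
(* Both are pointwise time derivatives of the same function on [J]; limits along a proper filter are
   unique. *)
have w'E : w' = u'.
  apply/funext => p; apply: (has_cderive_within_unique PF _ (du p)).
  apply: (@eq_has_cderive_within _ _ _ (fun s => w s p)) => // [s Js|].
    by rewrite wu.
  apply: has_cderive_within_sum => i; apply: has_cderive_within_sum => j.
  have := has_cderive_withinZ (fourier (i%:Z - N%:Z) (j%:Z - N%:Z) p) (ddft i j).
  by rewrite mulrC; congr has_cderive_within; apply/funext => s; rewrite mulrC.
split; last by exists w; rewrite -?w'E.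
apply/SN_trig; exists (\matrix_(i, j) dft u' i j) => p.
apply: etrans (congr1 (@^~ p) (esym w'E)) _.
by apply: eq_bigr => i _; apply: eq_bigr => j _; rewrite mxE.
Qed.

End DiscreteFourier.

(** * Conservation of energy along the Galerkin solution *)

Theorem proposition3p1 (R : realType) (N : nat) (a b c d gamma delta : R)
    (zeta0 v10 v20 : (R * R)%type -> R) (J : set R)
    (zeta : R -> scalar_field R) (v : R -> vector_field R) :
  (1 <= N)%N ->
  0 <= gamma -> gamma < 1 -> 0 < delta ->
  0 <= b -> 0 <= d -> b = d ->
  L2 zeta0 -> L2 v10 -> L2 v20 ->
  periodic2 zeta0 -> periodic2 v10 -> periodic2 v20 ->
  galerkin_solution N a b c d gamma delta zeta0 v10 v20 J zeta v ->
  forall t, J t ->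
    has_cderive_within J (fun s => energy a c gamma delta (zeta s) (v s)) t 0.
Proof.
move=> _ _ _ _ b0 _ bd _ _ _ _ _ _ [_ _ uN eqs _] t Jt; subst d.
(* Either [t] is isolated in [J] and the punctured filter is degenerate, or the filter is proper. *)
have [F0|/dnbhs_within_proper PF] := pselect (within J (dnbhs t) set0).
  by split; exact: has_derive_within_isolated.
have [z' [v' [dz dv1 dv2 mass momentum]]] := eqs t Jt.
have zN s : J s -> SN N (zeta s) by move=> /uN[].
have v1N s : J s -> SN N (v s).1 by move=> /uN[].
have v2N s : J s -> SN N (v s).2 by move=> /uN[].
have [tz' [z tz zE]] := galerkin_tfam Jt PF zN dz.
have [tv1' [w1 tw1 w1E]] := galerkin_tfam Jt PF v1N dv1.
have [tv2' [w2 tw2 w2E]] := galerkin_tfam Jt PF v2N dv2.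
have rate := energy_rate b0 (iffLR (SN_trig _ _) (zN t Jt)) tz'
  (iffLR (SN_trig _ _) (v1N t Jt)) (iffLR (SN_trig _ _) (v2N t Jt)) tv1' tv2'
  mass momentum.
pose tsq u u' (tu : tfam J t u u') := tfam_mul tu tu.
pose tgrad u u' (tu : tfam J t u u') :=
  tfam_add (tsq _ _ (tfam_pd (1, 0) tu)) (tsq _ _ (tfam_pd (0, 1) tu)).
(* The energy density is assembled from the rules for families, with squares as products, so that
   its time derivative is produced along with it. *)
have tH := tfam_add (tfam_add (tfam_add
   (tfam_scale (- (real_complex R (c' gamma c))) (tgrad _ _ tz))
   (tfam_scale (- (real_complex R a)) (tfam_add (tgrad _ _ tw1) (tgrad _ _ tw2))))
   (tfam_mul (tfam_add (tfam_cst J t (real_complex R (r1 gamma delta)))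
                       (tfam_scale (real_complex R (lambda gamma delta)) tz))
             (tfam_add (tsq _ _ tw1) (tsq _ _ tw2))))
   (tfam_scale (real_complex R (r2 gamma)) (tsq _ _ tz)).
have := tfam_cintegral tH.
(* At time [t] the families coincide with the solution, and the derivative produced is the integrand
   of [energy_rate] up to ring identities. *)
rewrite [X in has_cderive_within _ _ _ X -> _](_ : _ = 0); last first.
  apply: etrans rate; congr cintegral; apply/funext => p.
  by rewrite /grad_dot zE// w1E// w2E//; ring.
(* The families agree with the solution on [J] only, which is all that a derivative within [J]
   sees. *)
apply: eq_has_cderive_within => // s Js.
rewrite /energy /sqn /grad /dx /dy partial_pd /= -zE// -w1E// -w2E//.
by congr cintegral; apply/funext => p; ring.
Qed.
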